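(* Let $G=SL_2(\mathbb{F}_q)$ with $q$ an odd prime power, and for $g\in G$ let $$\mathcal{N}(g)=\frac{\#\{(x,y)\in G\times G:\ xyx^{-1}y^{-1}=g\}}{\#G}.$$ Then for $g\in G$ with $g\neq\pm I$, $$\mathcal{N}(g)=1+O(1/q).$$ That is, there are absolute constants $C>0$ and $q_0$ such that for every odd prime power $q\ge q_0$ and every $g\in SL_2(\mathbb{F}_q)\smallsetminus\{\pm I\}$ one has $|\mathcal{N}(g)-1|\le C/q$.
   Context: $\mathbb{F}_q$ is the finite field with $q$ elements, $q$ odd; $I$ is the identity matrix. For sequences, $a(q)=O(b(q))$ means that there is $C$ with $|a(q)|\le C|b(q)|$ for all sufficiently large $q$; here the bound is uniform in $g$. *)

(* Defs.v *)
From HB Require Import structures.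
From mathcomp Require Import all_boot all_order all_algebra all_fingroup.

Set Implicit Arguments.
Unset Strict Implicit.
Unset Printing Implicit Defensive.

Import GRing.Theory.

Local Open Scope ring_scope.

Definition SL2 (F : finFieldType) : {set {'GL_2[F]}} :=
  [set u : {'GL_2[F]} | \det (GLval u) == 1].

Lemma SL2_group_set (F : finFieldType) : group_set (SL2 F).
Proof.
apply/group_setP; split=> [|u v]; rewrite !inE ?GL_1E ?det1 //.
by move=> /eqP du /eqP dv; rewrite GL_MxE det_mulmx du dv mulr1.
Qed.

Canonical SL2_group (F : finFieldType) := Group (SL2_group_set F).

(* The commutator is spelled out because MathComp's [~ x, y] is
   x^-1 * y^-1 * x * y. *)
Definition comm_fiber (F : finFieldType) (g : {'GL_2[F]}) :
    {set {'GL_2[F]} * {'GL_2[F]}} :=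
  [set p in setX (SL2 F) (SL2 F) |
     (p.1 * p.2 * p.1^-1 * p.2^-1)%g == g].

Definition commN (R : realFieldType) (F : finFieldType) (g : {'GL_2[F]}) : R :=
  #|comm_fiber g|%:R / #|SL2 F|%:R.
Arguments commN R {F} g.

(* Main.v *)
Require Import Defs.
From HB Require Import structures.
From mathcomp Require Import all_boot all_order all_algebra all_fingroup.
From mathcomp Require Import ring lra zify.

(* The equation x y x^-1 y^-1 = g says that y conjugates z = x^-1 to z g, so the
   fiber is counted by the sum over z in SL_2(F_q) of the number T(z) of y in
   SL_2(F_q) with y z = z g y. This number vanishes unless tr z = tr (z g).
   If moreover (tr z)^2 <> 4, then z and z g are conjugate in GL_2 to the matrix
   x + J, where x = (tr z) / 2 and J^2 = D := x^2 - 1, and T(z) is the number of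
   points of a conic a^2 - D c^2 = n with n <> 0 and D <> 0, which is q + O(1).
   The condition tr z = tr (z g) cuts the quadric det z = 1 in q^2 + O(q) points,
   O(q) of which have (tr z)^2 = 4, and T(z) <= 2 q for those. The total is
   q^3 + O(q^2), as is the order of SL_2(F_q). *)

Set Implicit Arguments.
Unset Strict Implicit.
Unset Printing Implicit Defensive.

Import Order.TTheory GRing.Theory Num.Theory.
Local Open Scope ring_scope.

(** * Counting by fibers and injections *)

Section Counting.

Variables (T U : finType) (f : T -> U).
Implicit Types (A : {set T}) (k : nat).

Lemma card_sum_fibers A : #|A| = (\sum_u #|[set x in A | f x == u]|)%N.
Proof.
rewrite -sum1_card (partition_big f xpredT) //=; apply: eq_bigr => u _.
by rewrite -sum1_card; apply: eq_bigl => x; rewrite inE.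
Qed.

Lemma leq_card_fibers A k :
  (forall u, #|[set x in A | f x == u]| <= k)%N -> (#|A| <= k * #|U|)%N.
Proof.
move=> Ak; rewrite card_sum_fibers mulnC -sum_nat_const.
by apply: leq_sum => u _; apply: Ak.
Qed.

Lemma leq_card_in A : {in A &, injective f} -> (#|A| <= #|U|)%N.
Proof. by move=> /card_in_imset <-; apply: max_card. Qed.

Lemma leq_card_in2 A (B : {set U}) :
  {in A &, injective f} -> {in A, forall x, f x \in B} -> (#|A| <= #|B|)%N.
Proof.
move=> /card_in_imset <- AB; apply/subset_leq_card/subsetP=> _ /imsetP[x Ax ->].
exact: AB.
Qed.

End Counting.

(** If 2 = 0, then [x + 1] is a fixed-point-free involution, and the pairs {x, x + 1} partition the
    field into blocks of size 2. *)
Lemma odd_card_2neq0 (F : finFieldType) : odd #|F| -> (2 : F) != 0.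
Proof.
apply: contraL => /eqP F2.
have fK : involutive (fun x : F => x + 1).
  by move=> x; rewrite -addrA -[1 + 1]/(2 : F) F2 addr0.
pose B := [set [set x; x + 1] | x : F].
have pB : partition B [set: F].
  apply/and3P; split.
  - apply/eqP/setP=> x; rewrite inE; apply/bigcupP.
    by exists [set x; x + 1]; [apply/imsetP; exists x | rewrite set21].
  - apply/trivIsetP=> _ _ /imsetP[x _ ->] /imsetP[y _ ->].
    apply: contraR => /pred0Pn[z] /andP[/=].
    rewrite !inE => /orP[]/eqP -> /orP[]/eqP.
    + by move->.
    + by move=> ->; rewrite fK setUC.
    + by move=> <-; rewrite fK setUC.
    + by move=> /(inv_inj fK) ->.
  by apply/imsetP=> -[x _ /setP/(_ x)]; rewrite !inE eqxx.
rewrite -cardsT (@card_uniform_partition _ 2 B) ?oddM ?andbF //.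
move=> _ /imsetP[x _ ->]; rewrite cards2 -subr_eq0 opprD addrA subrr add0r.
by rewrite oppr_eq0 oner_eq0.
Qed.

(** The leading coefficient may vanish, so that linear equations and equations with parameters are
    covered too. *)
Lemma card_quadratic_roots (F : finFieldType) (a b c : F) :
  [|| a != 0, b != 0 | c != 0] ->
  (#|[set x : F | (a * x ^+ 2 + b * x + c == 0)%R]| <= 2)%N.
Proof.
move=> abc0; pose p := Poly [:: c; b; a].
have p0 : p != 0.
  apply: contraL abc0 => /eqP/polyP p0.
  move: (p0 0) (p0 1) (p0 2); rewrite !coef_Poly !coef0 /= => -> -> ->.
  by rewrite eqxx.
set A := [set x | _].
have: (size (enum A) < size p)%N.
  apply: max_poly_roots => //; last exact: enum_uniq.
  apply/allP=> x; rewrite mem_enum inE => /eqP xA; apply/rootP.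
  by rewrite horner_Poly /= -[RHS]xA; ring.
move=> lt_p; rewrite cardE -ltnS; apply: leq_trans lt_p _.
exact: leq_trans (size_Poly _) _.
Qed.

(** * Points of a conic *)

Section Conic.

Variable F : finFieldType.
Implicit Types (D n : F).

Definition conic D n : {set F * F} :=
  [set p : F * F | p.1 ^+ 2 - D * p.2 ^+ 2 == n].

(** Each [y] leaves at most two values of [x]. Degenerate conics are included, which is what traces
    2 and -2 require, where D = 0. *)
Lemma card_conic_le D n : (#|conic D n| <= 2 * #|F|)%N.
Proof.
apply: (@leq_card_fibers _ _ snd) => y.
apply: leq_trans (@card_quadratic_roots F 1 0 (- D * y ^+ 2 - n) _); last first.
  by rewrite oner_eq0.
apply: (@leq_card_in2 _ _ fst) => -[x1 y1]; first last.
  rewrite !inE /= => /andP[/eqP <- /eqP ->]; apply/eqP; ring.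
by case=> x2 y2; rewrite !inE /= => /andP[_ /eqP->] /andP[_ /eqP ->] ->.
Qed.

Lemma card_squares (a b : F) : a != 0 ->
  (#|F| <= 2 * #|[set (a * x ^+ 2 + b)%R | x : F]|)%N.
Proof.
move=> a0; set S := [set _ | x : F].
rewrite -cardsT (card_sum_fibers (fun x => a * x ^+ 2 + b)).
rewrite (bigID (mem S)) /= [X in (_ + X)%N]big1 => [|u uS]; last first.
  apply/eqP; rewrite cards_eq0; apply/eqP/setP=> x; rewrite !inE /=.
  by apply: contraNF uS => /eqP <-; apply: imset_f.
rewrite addn0 mulnC -sum_nat_const; apply: leq_sum => u _.
apply: leq_trans (@card_quadratic_roots F a 0 (b - u) _); last by rewrite a0.
apply: subset_leq_card; apply/subsetP=> x; rewrite !inE /= => /eqP <-.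
by apply/eqP; ring.
Qed.

(** Pigeonhole: a quadratic map takes each value at most twice, so [A] and [B] each have more than
    half of the elements, #|F| being odd, and they meet. *)
Lemma conic_neq0 D n : odd #|F| -> D != 0 -> conic D n != set0.
Proof.
move=> oddF D0; pose A := [set (1 * x ^+ 2 + 0 : F)%R | x : F].
pose B := [set (D * x ^+ 2 + n : F)%R | x : F].
have cA : (#|F| <= 2 * #|A|)%N by apply: card_squares; apply: oner_neq0.
have cB : (#|F| <= 2 * #|B|)%N by apply: card_squares.
have cAB : (#|A :|: B| <= #|F|)%N := max_card _.
have: A :&: B != set0.
  rewrite -cards_eq0; have := cardsUI A B; lia.
case/set0Pn=> _ /setIP[/imsetP[x _ ->] /imsetP[y _ /eqP E]].
apply/set0Pn; exists (x, y); rewrite inE /=.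
by move: E; rewrite mul1r addr0 => /eqP ->; apply/eqP; ring.
Qed.

(* Stereographic projection from a point [(x0, y0)] of the conic: a slope [m]
   outside at most three exceptional ones corresponds to the second point of
   intersection of the conic with the line [x - x0 = m (y - y0)]. *)
Lemma card_conic D n : odd #|F| -> D != 0 -> n != 0 ->
  (#|F| <= #|conic D n| + 4)%N /\ (#|conic D n| <= #|F| + 4)%N.
Proof.
move=> oddF D0 n0; have F2 := odd_card_2neq0 oddF.
have /set0Pn[[x0 y0]] := conic_neq0 n oddF D0; rewrite inE /= => /eqP E0.
split.
  (* Substituting the line and dividing by k = y - y0 gives k (m^2 - D) = 2 (D y0 - m x0). [M1]
     holds the slopes without a second point, [M2] the tangent slope, where k = 0. The bound 2 for
     each gives the 4. *)
  pose M1 := [set m : F | 1 * m ^+ 2 + 0 * m - D == 0].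
  pose M2 := [set m : F | 0 * m ^+ 2 + x0 * m - D * y0 == 0].
  have c1 : (#|M1| <= 2)%N by apply: card_quadratic_roots; rewrite oner_eq0.
  have c2 : (#|M2| <= 2)%N.
    apply: card_quadratic_roots; rewrite eqxx /= oppr_eq0 mulf_eq0 (negPf D0) /=.
    apply: contraNT n0; rewrite negb_or !negbK => /andP[/eqP x00 /eqP y00].
    by rewrite -E0 x00 y00; apply/eqP; ring.
  have cM : (#|~: (M1 :|: M2)| <= #|conic D n|)%N.
    pose k m := 2 * (D * y0 - m * x0) / (m ^+ 2 - D).
    have k0 m : m \in ~: (M1 :|: M2) -> (m ^+ 2 - D != 0) /\ k m != 0.
      rewrite !inE negb_or !mul0r add0r addr0 mul1r => /andP[m1 m2]; split => //.
      rewrite /k !mulf_neq0 ?invr_eq0 //.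
      by apply: contraNneq m2 => E; rewrite mulrC -opprB E oppr0.
    apply: (@leq_card_in2 _ _ (fun m => (x0 + m * k m, y0 + k m))).
      move=> m1 m2 /k0[_ km1] /k0[_ km2] [E /addrI k12].
      by move: E; rewrite k12 => /addrI/(mulIf km2).
    move=> m /k0[m1 _]; rewrite inE /=; apply/eqP; rewrite -E0 /k; field.
    exact: m1.
  have cC := cardsC (M1 :|: M2); have cU := cardsUI M1 M2.
  apply: leq_trans (leq_add cM (leqnn 4)).
  by rewrite -cC addnC; move: c1 c2 cU; lia.
(* No slope is defined when y = y0; this happens only at (x0, y0) and (-x0, y0). *)
pose K1 := [set p in conic D n | p.2 == y0].
pose K2 := conic D n :\: K1.
have c1 : (#|K1| <= 2)%N.
  apply: leq_trans (@card_quadratic_roots F 1 0 (- x0 ^+ 2) _); last first.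
    by rewrite oner_eq0.
  apply: (@leq_card_in2 _ _ fst) => -[x1 y1].
    by case=> x2 y2; rewrite !inE /= => /andP[_ /eqP->] /andP[_ /eqP ->] ->.
  rewrite !inE /= => /andP[/eqP E /eqP Ey]; apply/eqP.
  by move: E; rewrite Ey -E0 => /addIr ->; ring.
have c2 : (#|K2| <= #|F|)%N.
  apply: (@leq_card_in _ _ (fun p => (p.1 - x0) / (p.2 - y0))).
  have line p : p \in K2 -> exists m k,
     [/\ (p.1 - x0) / (p.2 - y0) = m, p = (x0 + m * k, y0 + k), m ^+ 2 != D
       & k = 2 * (D * y0 - m * x0) / (m ^+ 2 - D)].
    case: p => x y; rewrite !inE /= => /andP[nK /eqP E].
    rewrite E eqxx /= in nK; rewrite -subr_eq0 in nK.
    exists ((x - x0) / (y - y0)), (y - y0).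
    have -> : (x, y) = (x0 + (x - x0) / (y - y0) * (y - y0), y0 + (y - y0)).
      by rewrite divfK // !(addrC _ (_ - _)) !subrK.
    set m := (x - x0) / _; set k := y - y0 in nK *.
    have Ex : x = x0 + m * k by rewrite divfK // addrC subrK.
    have Ey : y = y0 + k by rewrite addrC subrK.
    have Ek : k * (m ^+ 2 - D) = 2 * (D * y0 - m * x0).
      apply: (mulIf nK); apply/eqP; rewrite -subr_eq0; apply/eqP.
      transitivity ((x ^+ 2 - D * y ^+ 2) - (x0 ^+ 2 - D * y0 ^+ 2)).
        by rewrite Ex Ey; ring.
      by rewrite E E0 subrr.
    (* Otherwise the equation for [k] forces x0 = m y0, and then n = x0^2 - m^2 y0^2 = 0. *)
    have mD : m ^+ 2 != D.
      apply: contraNneq n0 => mD.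
      have m0 : m != 0 by apply: contraNneq D0 => m0; rewrite -mD m0 expr0n.
      have : 2 * m * (m * y0 - x0) == 0.
        by move: Ek; rewrite -mD subrr mulr0 => Ek; apply/eqP; rewrite Ek; ring.
      rewrite mulf_eq0 (negPf (mulf_neq0 F2 m0)) /= subr_eq0 => /eqP xm.
      by rewrite -E0 -xm -mD; apply/eqP; ring.
    by split=> //; apply: canRL (mulfK _) Ek; rewrite subr_eq0.
  move=> p1 p2 /line[m1 [k1 [-> -> _ ->]]] /line[m2 [k2 [-> -> _ ->]]].
  by move->.
rewrite -(cardsID K1) addnC; apply: leq_add => //.
by apply: leq_trans (subset_leq_card (subsetIr _ _)) _; apply: leq_trans c1 _.
Qed.

End Conic.

(** * Two by two matrices *)

Section Matrix2.

Variable R : comNzRingType.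
Implicit Types a b c d : R.

Definition mx2 a b c d : 'M[R]_2 :=
  \matrix_(i, j) if i == 0 then if j == 0 then a else b
                 else if j == 0 then c else d.

Lemma mx2_eta (A : 'M[R]_2) : A = mx2 (A 0 0) (A 0 1) (A 1 0) (A 1 1).
Proof.
by apply/matrixP=> i j; rewrite mxE; case: (unliftP 0 i) => [i'|] ->;
   case: (unliftP 0 j) => [j'|] ->; rewrite ?ord1 //;
   congr (A _ _); apply: val_inj.
Qed.

Lemma mx2_inj a b c d a' b' c' d' :
  mx2 a b c d = mx2 a' b' c' d' -> [/\ a = a', b = b', c = c' & d = d'].
Proof.
move/matrixP=> E.
by have:= E 0 0; have:= E 0 1; have:= E 1 0; have:= E 1 1; rewrite !mxE /=.
Qed.

Lemma mulmx2 a b c d a' b' c' d' :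
  mx2 a b c d *m mx2 a' b' c' d' =
  mx2 (a * a' + b * c') (a * b' + b * d') (c * a' + d * c') (c * b' + d * d').
Proof.
rewrite [LHS]mx2_eta; congr mx2;
by rewrite mxE big_ord_recl big_ord1 !mxE.
Qed.

Lemma det_mx2 a b c d : \det (mx2 a b c d) = a * d - b * c.
Proof.
rewrite (expand_det_row _ 0) big_ord_recl big_ord1 /cofactor !det_mx11 !mxE /=.
by rewrite expr0 expr1; ring.
Qed.

Lemma tr_mx2 a b c d : \tr (mx2 a b c d) = a + d.
Proof. by rewrite /mxtrace big_ord_recl big_ord1 !mxE. Qed.

Lemma scalar_mx2 a : a%:M = mx2 a 0 0 a.
Proof. by rewrite [LHS]mx2_eta; congr mx2; rewrite mxE. Qed.

Lemma is_scalar_mx2 a b c d :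
  is_scalar_mx (mx2 a b c d) = [&& b == 0, c == 0 & a == d].
Proof.
apply/is_scalar_mxP/and3P => [[x]|[/eqP-> /eqP-> /eqP->]]; last first.
  by exists d; rewrite scalar_mx2.
by rewrite scalar_mx2 => /mx2_inj[-> -> -> ->].
Qed.

End Matrix2.

Section Conjugacy.

Variable F : fieldType.
Implicit Types A B P : 'M[F]_2.

(* The rows of [P] are a cyclic vector [v] of [A] and [v *m A]. *)
Lemma companion_conj A : ~~ is_scalar_mx A ->
  exists2 P, P \in unitmx & P *m A = mx2 0 1 (- \det A) (\tr A) *m P.
Proof.
rewrite [A]mx2_eta; move: (A 0 0) (A 0 1) (A 1 0) (A 1 1) => a b c d.
rewrite is_scalar_mx2 det_mx2 tr_mx2 => nscal.
pose P u v := mx2 u v (u * a + v * c) (u * b + v * d).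
suff [u [v uP]] : exists u v, \det (P u v) != 0.
  exists (P u v); first by rewrite unitmxE unitfE.
  by rewrite !mulmx2; congr mx2; ring.
(* The vectors (1, 0), (0, 1) and (1, 1) are tried in turn; all three fail only if b = c = 0 and a =
   d. *)
have [b0|b0] := eqVneq b 0; last first.
  by exists 1, 0; rewrite det_mx2 (_ : _ - _ = b) //; ring.
have [c0|c0] := eqVneq c 0; last first.
  by exists 0, 1; rewrite det_mx2 (_ : _ - _ = - c) ?oppr_eq0 //; ring.
exists 1, 1; rewrite det_mx2 b0 c0 (_ : _ - _ = d - a); last by ring.
by rewrite subr_eq0 eq_sym; move: nscal; rewrite b0 c0 !eqxx.
Qed.

(** Both matrices are conjugate to the same companion matrix. *)
Lemma nonscalar_conj A B : ~~ is_scalar_mx A -> ~~ is_scalar_mx B ->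
  \det A = \det B -> \tr A = \tr B ->
  exists2 P, P \in unitmx & P *m A = B *m P.
Proof.
move=> /companion_conj[P uP EP] /companion_conj[Q uQ EQ] Edet Etr.
exists (invmx Q *m P); first by rewrite unitmx_mul unitmx_inv uQ uP.
rewrite -mulmxA EP Edet Etr; apply: (canLR (mulKmx uQ)).
by rewrite !mulmxA EQ mulmxK.
Qed.

End Conjugacy.

(** * Conjugating elements *)

Section Transporter.

Variable F : finFieldType.
Implicit Types z w Y g : 'M[F]_2.

(** When nonempty, a coset of the centralizer of [z] in SL_2. Writing the condition without an
    inverse lets [Y] range over plain matrices. *)
Definition transporter z w :=
  [set Y : 'M[F]_2 | (\det Y == 1) && (Y *m z == w *m Y)].

Lemma transporter_unit z w Y : Y \in transporter z w -> Y \in unitmx.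
Proof. by rewrite inE unitmxE unitfE => /andP[/eqP-> _]; rewrite oner_neq0. Qed.

Lemma transporter_tr z w Y : Y \in transporter z w -> \tr z = \tr w.
Proof.
move=> TY; have uY := transporter_unit TY; move: TY.
rewrite inE => /andP[_ /eqP E].
by rewrite -(mulKmx uY z) mxtrace_mulC E mulmxK.
Qed.

Lemma transporter_scalarl z w Y :
  is_scalar_mx z -> Y \in transporter z w -> w = z.
Proof.
move=> /is_scalar_mxP[a ->] TY; have uY := transporter_unit TY; move: TY.
rewrite inE => /andP[_ /eqP E].
by rewrite -(mulmxK uY w) -E scalar_mxC mulmxK.
Qed.

Lemma transporter_scalarr z w Y :
  is_scalar_mx w -> Y \in transporter z w -> z = w.
Proof.
move=> /is_scalar_mxP[a ->] TY; have uY := transporter_unit TY; move: TY.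
rewrite inE => /andP[_ /eqP E].
by rewrite -(mulKmx uY z) E -scalar_mxC mulKmx.
Qed.

Hypothesis oddF : odd #|F|.

(** With P z = J P and Q w = J Q, the map sending Y to Q Y P^-1 turns Y z = w Y into commutation
    with [J]. The commutant of [J] consists of the matrices [W (a, c)], of determinant a^2 - D c^2,
    and det Y = 1 becomes a^2 - D c^2 = det Q / det P. *)
Lemma card_transporter z w : ~~ is_scalar_mx z -> ~~ is_scalar_mx w ->
  \det z = 1 -> \det w = 1 -> \tr z = \tr w ->
  exists2 n, n != 0 & #|transporter z w| = #|conic ((\tr z / 2) ^+ 2 - 1) n|.
Proof.
move=> nz nw dz dw Etr; have F2 := odd_card_2neq0 oddF.
set x := \tr z / 2; set D := _ - 1; pose J := mx2 x D 1 x.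
have nJ : ~~ is_scalar_mx J by rewrite is_scalar_mx2 oner_eq0 andbF.
have dJ : \det J = 1 by rewrite det_mx2 /D; ring.
have tJ : \tr J = \tr z by rewrite tr_mx2 /x; field.
have [P uP EP] := nonscalar_conj nz nJ (etrans dz (esym dJ)) (esym tJ).
have [Q uQ EQ] := nonscalar_conj nw nJ (etrans dw (esym dJ))
                    (etrans (esym Etr) (esym tJ)).
have [dP dQ] : \det P != 0 /\ \det Q != 0 by rewrite -!unitfE -!unitmxE.
exists (\det Q / \det P); first by rewrite mulf_neq0 ?invr_eq0.
pose W (p : F * F) := mx2 p.1 (D * p.2) p.2 p.1.
pose f p := invmx Q *m W p *m P.
have fK : injective f.
  move=> [a b] [a' b'] /(can_inj (mulmxK uP)).
  by move=> /(can_inj (mulKVmx uQ)) /mx2_inj[/= -> _ -> _].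
rewrite -(card_imset _ fK); congr #|pred_of_set _|; apply/setP=> Y.
apply/idP/imsetP=> [|[p]].
  rewrite inE => /andP[/eqP dY /eqP EY].
  have E : Q *m Y *m invmx P *m J = J *m (Q *m Y *m invmx P).
    rewrite !mulmxA -EQ -(mulmxA Q w) -EY -!mulmxA; congr (_ *m (_ *m _)).
    by apply: (canRL (mulmxK uP)); rewrite -mulmxA -EP mulKmx.
  have EW : Y = invmx Q *m (Q *m Y *m invmx P) *m P.
    by rewrite !mulmxA mulVmx // mul1mx mulmxKV.
  have : \det (Q *m Y *m invmx P) = \det Q / \det P.
    by rewrite !det_mulmx det_inv dY mulr1.
  move: E EW; rewrite [Q *m Y *m _]mx2_eta.
  move: (_ 0 0) (_ 0 1) (_ 1 0) (_ 1 1) => a b c d.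
  rewrite !mulmx2 => /mx2_inj[E00 _ E10 _] EW.
  rewrite mulr1 in E00; rewrite mulr1 in E10.
  have Eb : b = D * c by apply: (addrI (a * x)); rewrite E00; ring.
  have Ed : d = a by apply: (addrI (c * x)); rewrite E10; ring.
  rewrite det_mx2 => En; exists (a, c); last by rewrite /f /W /= -Eb -{2}Ed.
  by rewrite inE /= -En Eb Ed; apply/eqP; ring.
rewrite inE => /eqP En ->; rewrite inE /f !det_mulmx det_inv det_mx2.
apply/andP; split.
  rewrite (_ : _ - _ = \det Q / \det P); last by rewrite -En; ring.
  by apply/eqP; field; rewrite dP dQ.
apply/eqP; rewrite -!mulmxA EP.
have -> : w *m (invmx Q *m (W p *m P)) = invmx Q *m (J *m (W p *m P)).
  by apply: (canRL (mulKmx uQ)); rewrite !mulmxA EQ mulmxK.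
by rewrite !mulmxA; congr (_ *m _); rewrite -!mulmxA; congr (_ *m _);
   rewrite !mulmx2; congr mx2; ring.
Qed.

(** If [z] or [w] were scalar, any element of the transporter would force w = z. A nonempty
    transporter is thus in bijection with a conic, possibly degenerate. *)
Lemma card_transporter_le z w : w != z -> \det z = 1 -> \det w = 1 ->
  (#|transporter z w| <= 2 * #|F|)%N.
Proof.
move=> nwz dz dw; have [->|/set0Pn[Y TY]] := eqVneq (transporter z w) set0.
  by rewrite cards0.
have nz : ~~ is_scalar_mx z.
  by apply: contraNN nwz => /transporter_scalarl/(_ TY)/eqP.
have nw : ~~ is_scalar_mx w.
  by apply: contraNN nwz => /transporter_scalarr/(_ TY)/eqP; rewrite eq_sym.
have [n _ ->] := card_transporter nz nw dz dw (transporter_tr TY).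
exact: card_conic_le.
Qed.

Lemma scalar_SL2_tr z : is_scalar_mx z -> \det z = 1 -> (\tr z) ^+ 2 = 4.
Proof.
move=> /is_scalar_mxP[a ->]; rewrite scalar_mx2 det_mx2 tr_mx2 => E.
by transitivity (4 * (a * a - 0 * 0)); [ring | rewrite E mulr1].
Qed.

(** The trace condition excludes scalar matrices and makes D = ((tr z)^2 - 4) / 4 nonzero, so the
    sharp conic count applies. *)
Lemma card_transporter_regular z w : \det z = 1 -> \det w = 1 ->
  \tr z = \tr w -> (\tr z) ^+ 2 != 4 ->
  (#|F| <= #|transporter z w| + 4)%N /\ (#|transporter z w| <= #|F| + 4)%N.
Proof.
move=> dz dw Etr t4; have F2 := odd_card_2neq0 oddF.
have nz : ~~ is_scalar_mx z.
  by apply: contraNN t4 => /scalar_SL2_tr ->.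
have nw : ~~ is_scalar_mx w.
  by apply: contraNN t4 => /scalar_SL2_tr; rewrite Etr => ->.
have [n n0 ->] := card_transporter nz nw dz dw Etr.
apply: card_conic => //; apply: contraNneq t4 => E.
rewrite -subr_eq0 (_ : _ - _ = 4 * ((\tr z / 2) ^+ 2 - 1)).
  by rewrite E mulr0.
by field.
Qed.

End Transporter.

(** * Matrices z of determinant 1 with tr z = tr (z g) *)

Section TraceLocus.

Variable F : finFieldType.
Implicit Types g : 'M[F]_2.

(** The predicate [p] lets one parametrization serve the whole locus, a single trace value and the
    traces with square 4. *)
Definition trace_locus g (p : pred F) :=
  [set z : 'M[F]_2 | [&& \det z == 1, \tr z == \tr (z *m g) & p (\tr z)]].

(** Conjugation by [P] preserves trace and determinant and carries z g to (P z P^-1) h. This reduces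
    the count to a companion matrix. *)
Lemma card_trace_locus_conj P g h p : P \in unitmx -> P *m g = h *m P ->
  #|trace_locus g p| = #|trace_locus h p|.
Proof.
move=> uP E; pose f z := P *m z *m invmx P.
have fK : injective f.
  by move=> u v /(can_inj (mulmxKV uP)) /(can_inj (mulKmx uP)).
rewrite -(card_imset _ fK); congr #|pred_of_set _|; apply/setP=> z.
have tr_f u : \tr (f u) = \tr u by rewrite mxtrace_mulC mulKmx.
have det_f u : \det (f u) = \det u.
  by rewrite !det_mulmx det_inv mulrAC divff ?mul1r // -unitfE -unitmxE.
have fM u : f u *m h = f (u *m g).
  by rewrite /f -!mulmxA; congr (_ *m (_ *m _)); apply: (canRL (mulmxK uP));
     rewrite -mulmxA -E mulKmx.
apply/imsetP/idP => [[u]|].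
  by rewrite !inE => /and3P[/eqP du tu pu] ->; rewrite det_f fM !tr_f du eqxx tu.
have -> : z = f (invmx P *m z *m P) by rewrite /f !mulmxA mulmxV // mul1mx mulmxK.
set u := invmx P *m z *m P => zl; exists u => //; move: zl.
by rewrite !inE det_f fM !tr_f.
Qed.

Variable g : 'M[F]_2.
Hypotheses (g_nscal : ~~ is_scalar_mx g) (det_g : \det g = 1).

Let C := mx2 0 1 (-1) (\tr g).

Lemma card_trace_locusC p : #|trace_locus g p| = #|trace_locus C p|.
Proof.
have [P uP] := companion_conj g_nscal; rewrite det_g => E.
exact: card_trace_locus_conj uP E.
Qed.

(* With [e = c + d], the conditions defining the locus of the companion matrix
   determine [a] and [c] linearly, and are linear in [b] with coefficient [e]. *)
Let locus_params p : {set F * F * F} :=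
  [set v | let: (b, e, d) := v in
    (b * e == e * d + (\tr g - 2) * d ^+ 2 - 1) && p (e - b + (\tr g - 1) * d)].

Lemma card_locus_params p : #|trace_locus g p| = #|locus_params p|.
Proof.
rewrite card_trace_locusC; set t := \tr g.
pose f (v : F * F * F) :=
  let: (b, e, d) := v in mx2 (e - b + (t - 2) * d) b (e - d) d.
have fK : injective f.
  move=> [[b e] d] [[b' e'] d'] /mx2_inj[_ -> E Ed].
  by move: E; rewrite Ed => /addIr->.
rewrite -(card_imset _ fK); congr #|pred_of_set _|; apply/setP=> z.
have in_locus a b c d : (mx2 a b c d \in trace_locus C p) =
    [&& b * (c + d) == (c + d) * d + (t - 2) * d ^+ 2 - 1,
        a == (c + d) - b + (t - 2) * d & p (a + d)].
  rewrite inE mulmx2 !tr_mx2 det_mx2.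
  have -> : (a + d == a * 0 + b * -1 + (c * 1 + d * t)) =
            (a == c + d - b + (t - 2) * d).
    by rewrite -subr_eq0 -[RHS]subr_eq0; congr (_ == 0); ring.
  have [-> /=|/=] := eqVneq a _; last by rewrite !andbF.
  congr (_ && _); rewrite -subr_eq0 -[RHS]subr_eq0 -[LHS]oppr_eq0.
  by congr (_ == 0); ring.
apply/idP/imsetP=> [|[[[b e] d]]]; last first.
  rewrite inE => /andP[/eqP E pE] ->; rewrite in_locus subrK E !eqxx /=.
  by rewrite (_ : _ + d = e - b + (t - 1) * d) //; ring.
rewrite [z]mx2_eta; move: (z 0 0) (z 0 1) (z 1 0) (z 1 1) => a b c d.
rewrite in_locus => /and3P[/eqP E /eqP Ea pE]; exists (b, c + d, d).
  by rewrite inE E eqxx -[X in p X](_ : a + d = _) // Ea; ring.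
by rewrite /f -Ea addrK.
Qed.

(** For e != 0 the pair (e, d) determines b. For e = 0, b is free and (tr g - 2) d^2 = 1 has at most
    two solutions. *)
Lemma card_trace_locus_le : (#|trace_locus g xpredT| <= #|F| ^ 2 + 2 * #|F|)%N.
Proof.
rewrite card_locus_params; set V := locus_params _.
rewrite -(cardsID [set v : F * F * F | v.1.2 == 0]) addnC; apply: leq_add.
  have -> : (#|F| ^ 2 = #|{: F * F}|)%N by rewrite card_prod mulnn.
  apply: (@leq_card_in _ _ (fun v => (v.1.2, v.2))).
  move=> [[b e] d] [[b' e'] d']; rewrite !inE !andbT /=.
  move=> /andP[e0 /eqP E] /andP[_ /eqP E'] [Ee Ed]; subst e' d'.
  by rewrite -E in E'; rewrite (mulIf e0 E').
apply: (@leq_card_fibers _ _ (fun v => v.1.1)) => b.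
apply: leq_trans (@card_quadratic_roots F (\tr g - 2) 0 (-1) _); last first.
  by rewrite oppr_eq0 oner_eq0 !orbT.
apply: (@leq_card_in2 _ _ snd) => [[[b1 e1] d1] [[b2 e2] d2]|[[b1 e1] d1]].
  rewrite !inE /= => /andP[/andP[_ /eqP->] /eqP->].
  by move=> /andP[/andP[_ /eqP->] /eqP->] ->.
rewrite !inE andbT /= => /andP[/andP[/eqP E /eqP e0] _].
by move: E; rewrite e0 mulr0 mul0r add0r addr0 => <-.
Qed.

(** The pairs (e, d) with e != 0 alone give q (q - 1) points. *)
Lemma card_trace_locus_ge : (#|F| ^ 2 <= #|trace_locus g xpredT| + #|F|)%N.
Proof.
rewrite card_locus_params; set V := locus_params _.
have : (#|setX [set~ (0 : F)%R] [set: F]| <= #|V|)%N.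
  pose b e d := (e * d + (\tr g - 2) * d ^+ 2 - 1) / e.
  apply: (@leq_card_in2 _ _ (fun v => (b v.1 v.2, v.1, v.2))).
    by move=> [e1 d1] [e2 d2] _ _ [_ -> ->].
  by move=> [e d]; rewrite !inE !andbT /= => e0; rewrite divfK.
rewrite cardsX cardsT cardsC1 => le_V.
apply: leq_trans (leq_add le_V (leqnn _)).
by rewrite addnC -mulSn prednK ?mulnn //; apply/card_gt0P; exists 0.
Qed.

(** The trace condition expresses b through e and d; substituting it leaves, for each d, a monic
    quadratic equation in e. *)
Lemma card_trace_locus1 s : (#|trace_locus g (pred1 s)| <= 2 * #|F|)%N.
Proof.
rewrite card_locus_params; set V := locus_params _.
set t := \tr g in V *.
apply: (@leq_card_fibers _ _ snd) => d.
apply: leq_trans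
  (@card_quadratic_roots F 1 ((t - 2) * d - s) (1 - (t - 2) * d ^+ 2) _).
  have Eb b e : e - b + (t - 1) * d == s -> b = e + (t - 1) * d - s.
    by move/eqP <-; ring.
  apply: (@leq_card_in2 _ _ (fun v => v.1.2))
    => [[[b1 e1] d1] [[b2 e2] d2]|[[b1 e1] d1]].
    rewrite !inE /= => /andP[/andP[_ E1] /eqP d1E] /andP[/andP[_ E2] /eqP d2E].
    by subst d1 d2; rewrite (Eb _ _ E1) (Eb _ _ E2) => ->.
  rewrite !inE /= => /andP[/andP[/eqP E1 E2] /eqP dE]; subst d1.
  move/eqP: E1; rewrite (Eb _ _ E2) -subr_eq0 => /eqP E1.
  by apply/eqP; rewrite -[RHS]E1; ring.
by rewrite oner_eq0.
Qed.

Lemma card_trace_locus_irregular :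
  (#|trace_locus g (fun s => (s ^+ 2 == 4)%R)| <= 4 * #|F|)%N.
Proof.
have c := leq_add (card_trace_locus1 2) (card_trace_locus1 (- (2))).
apply: leq_trans (leq_trans _ c) _; last by rewrite -mulnDl.
apply: leq_trans (leq_card_setU _ _).
apply: subset_leq_card; apply/subsetP=> z; rewrite !inE => /and3P[-> -> /=].
have -> : (4 : F) = 2 ^+ 2 by ring.
by rewrite eqf_sqr.
Qed.

End TraceLocus.

(** * The order of SL_2 *)

Section SpecialLinear.

Variable F : finFieldType.

Lemma card_SL2E : #|SL2 F| = #|[set A : 'M[F]_2 | \det A == 1]|.
Proof.
rewrite -(card_imset _ (@val_inj _ _ _)); congr #|pred_of_set _|.
apply/setP=> A; rewrite inE; apply/imsetP/idP => [[u]|dA].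
  by rewrite inE => dA ->.
have uA : A \in unitmx by rewrite unitmxE (eqP dA) unitr1.
by exists (Sub A uA) => //; rewrite inE.
Qed.

(** If the corner entry a is nonzero, then (a, b, c) determines d. If a = 0, then b c = -1, so (b,
    d) determines c. *)
Lemma card_SL2_le : (#|SL2 F| <= #|F| ^ 3 + #|F| ^ 2)%N.
Proof.
rewrite card_SL2E; set S := [set A | _].
rewrite -(cardsID [set A : 'M[F]_2 | A 0 0 == 0]) addnC; apply: leq_add.
  have -> : (#|F| ^ 3 = #|{: F * F * F}|)%N by rewrite !card_prod mulnn -expnSr.
  apply: (@leq_card_in _ _ (fun A : 'M[F]_2 => (A 0 0, A 0 1, A 1 0))) => A B.
  rewrite [A]mx2_eta [B]mx2_eta !inE !det_mx2 !mxE /=.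
  move: (A 0 0) (A 0 1) (A 1 0) (A 1 1) (B 0 0) (B 0 1) (B 1 0) (B 1 1).
  move=> a b c d a' b' c' d' /andP[a0 /eqP E] /andP[_ /eqP E'] [Ea Eb Ec].
  subst a' b' c'; congr mx2; apply: (mulfI a0); rewrite -E' in E.
  exact: addIr E.
have -> : (#|F| ^ 2 = #|{: F * F}|)%N by rewrite card_prod mulnn.
apply: (@leq_card_in _ _ (fun A : 'M[F]_2 => (A 0 1, A 1 1))) => A B.
rewrite [A]mx2_eta [B]mx2_eta !inE !det_mx2 !mxE /=.
move: (A 0 0) (A 0 1) (A 1 0) (A 1 1) (B 0 0) (B 0 1) (B 1 0) (B 1 1).
move=> a b c d a' b' c' d' /andP[/eqP E /eqP a0] /andP[/eqP E' /eqP a0'] [Eb Ed].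
subst a a' b' d'; congr mx2; rewrite !mul0r !sub0r in E E'.
have b0 : b != 0.
  by apply: contra_eq_neq E => ->; rewrite mul0r oppr0 eq_sym oner_eq0.
by apply: (mulfI b0); apply: oppr_inj; rewrite E.
Qed.

Lemma card_SL2_ge : (#|F| ^ 3 <= #|SL2 F| + #|F| ^ 2)%N.
Proof.
rewrite card_SL2E; set S := [set A | _].
have : (#|setX [set~ (0 : F)%R] [set: F * F]| <= #|S|)%N.
  apply: (@leq_card_in2 _ _
    (fun v => mx2 v.1 v.2.1 v.2.2 ((1 + v.2.1 * v.2.2) / v.1))).
    by move=> [a [b c]] [a' [b' c']] _ _ /mx2_inj[/= -> -> -> _].
  move=> [a [b c]]; rewrite !inE andbT /= => a0.
  by rewrite det_mx2 mulrC divfK // addrK.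
rewrite cardsX cardsT card_prod cardsC1 => le_S.
apply: leq_trans (leq_add le_S (leqnn _)).
by rewrite addnC mulnn -mulSn prednK -?expnS //; apply/card_gt0P; exists 0.
Qed.

End SpecialLinear.

Lemma GLval_inj n (R : finComUnitRingType) : injective (@GLval n R).
Proof. exact: (@val_inj _ _ {'GL_n[R]}). Qed.

(** * The commutator fiber *)

Section CommutatorFiber.

Variables (F : finFieldType) (g : {'GL_2[F]}).
Hypothesis gSL : g \in SL2 F.

Let det_g : \det (GLval g) = 1. Proof. by move: gSL; rewrite inE => /eqP. Qed.

(* [x y x^-1 y^-1 = g] says that [y] conjugates [x^-1] to [x^-1 g]. *)
Lemma card_comm_fiber : #|comm_fiber g| =
  (\sum_(z : 'M[F]_2 | (\det z == 1)%R) #|transporter z (z *m GLval g)|)%N.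
Proof.
pose f (p : {'GL_2[F]} * {'GL_2[F]}) : 'M[F]_2 := GLval (p.1^-1)%g.
rewrite (card_sum_fibers f) [RHS]big_mkcond; apply: eq_bigr => z _.
case: ifP => [dz|dz]; last first.
  apply/eqP; rewrite cards_eq0; apply/eqP/setP=> p; rewrite !inE.
  apply: contraFF dz => /andP[/andP[/andP[dx _] _] /eqP <-].
  by rewrite /f GL_VxE det_inv (eqP dx) invr1.
have uz : z \in unitmx by rewrite unitmxE (eqP dz) unitr1.
pose h (p : {'GL_2[F]} * {'GL_2[F]}) : 'M[F]_2 := GLval p.2.
rewrite -(@card_in_imset _ _ h); last first.
  move=> [x y] [x' y']; rewrite !inE => /andP[_ /eqP <-] /andP[_ /eqP Ex] Ey.
  rewrite (invg_inj (GLval_inj (Ex : GLval x'^-1%g = GLval x^-1%g))).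
  by rewrite (GLval_inj (Ey : GLval y = GLval y')).
congr #|pred_of_set _|; apply/setP=> Y; apply/imsetP/idP => [[[x y]]|TY].
  rewrite !inE => /andP[/andP[/andP[dx dy] /eqP E] /eqP Ez] ->.
  apply/andP; split; first exact: dy.
  apply/eqP; rewrite -(Ez : GLval x^-1%g = z).
  suff : GLval (y * x^-1)%g = GLval (x^-1 * g * y)%g by rewrite !GL_MxE.
  congr GLval.
  by rewrite -(E : (x * y * x^-1 * y^-1)%g = g) !mulgA mulVg mul1g mulgKV.
have uY := transporter_unit TY.
pose u : {'GL_2[F]} := Sub z uz; pose y : {'GL_2[F]} := Sub Y uY.
move: TY; rewrite inE => /andP[dY /eqP EY].
have E : (y * u = u * g * y)%g by apply: GLval_inj; rewrite !GL_MxE; apply: EY.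
have fu : f (u^-1, y)%g = z by rewrite /f invgK.
exists (u^-1, y)%g => //; rewrite !inE fu eqxx andbT -andbA; apply/and3P; split.
- by apply/eqP; rewrite GL_VxE det_inv (eqP dz : \det (GLval u) = 1) invr1.
- exact: dY.
- apply/eqP; change ((u^-1 * y * u^-1^-1 * y^-1)%g = g).
  by rewrite invgK -(mulgA u^-1%g) E !mulgA mulVg mul1g mulgK.
Qed.

Hypotheses (oddF : odd #|F|) (g1 : GLval g != 1%:M) (gN1 : GLval g != - 1%:M).

Let g_nscal : ~~ is_scalar_mx (GLval g).
Proof.
apply/is_scalar_mxP=> -[a Ea]; move: det_g g1 gN1; rewrite Ea det_scalar.
move/eqP; rewrite sqrf_eq1 => /orP[] /eqP ->; first by rewrite eqxx.
by rewrite raddfN /= eqxx.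
Qed.

(** [L] contains every [z] with a nonempty transporter, conjugate matrices having equal traces; [L1]
    is its irregular part, of trace 2 or -2. *)
Let L := trace_locus (GLval g) xpredT.
Let L1 := trace_locus (GLval g) (fun s => s ^+ 2 == 4).
Let T z := #|transporter z (z *m GLval g)|.

Let card_comm_fiberE :
  #|comm_fiber g| = (\sum_(z in L1) T z + \sum_(z in L :\: L1) T z)%N.
Proof.
rewrite card_comm_fiber (bigID (mem L)) /= [X in (_ + X)%N]big1 ?addn0.
  rewrite (bigID (mem L1)) /=; congr (_ + _)%N; apply: eq_bigl => z.
    by rewrite !inE andbT -!andbA; case: (_ == 1); case: (_ == _); rewrite ?andbF.
  rewrite !inE andbT -!andbA.
  by case: (_ == 1); case: (_ == _); rewrite ?andbF ?andbT.
move=> z /andP[dz zL]; apply/eqP; rewrite cards_eq0.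
apply: contraNT zL => /set0Pn[Y /transporter_tr E].
by rewrite !inE dz /= andbT; apply/eqP.
Qed.

Let in_L z : z \in L ->
  [/\ \det z = 1, \det (z *m GLval g) = 1 & \tr z = \tr (z *m GLval g)].
Proof.
by rewrite inE andbT => /andP[/eqP dz /eqP tz]; rewrite det_mulmx dz det_g mulr1.
Qed.

Let regularP z : z \in L :\: L1 -> (#|F| <= T z + 4)%N /\ (T z <= #|F| + 4)%N.
Proof.
rewrite inE => /andP[zL1 zL]; have [dz dzg tz] := in_L zL.
apply: card_transporter_regular => //; apply: contraNN zL1 => t4.
by rewrite inE t4 andbT; move: zL; rewrite inE andbT.
Qed.

Let L1_sub : L1 \subset L.
Proof. by apply/subsetP=> z; rewrite !inE => /and3P[-> ->]. Qed.

(** The irregular [z] contribute at most 4q * 2q and the others at most (q^2 + 2q)(q + 4); in total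
    q^3 + 14 q^2 + 8q. *)
Lemma card_comm_fiber_le : (#|comm_fiber g| <= #|F| ^ 3 + 22 * #|F| ^ 2)%N.
Proof.
have le1 : (\sum_(z in L1) T z <= 4 * #|F| * (2 * #|F|))%N.
  apply: leq_trans (leq_mul (card_trace_locus_irregular g_nscal det_g) (leqnn _)).
  rewrite -sum_nat_const; apply: leq_sum => z zL1.
  have [dz dzg tz] := in_L (subsetP L1_sub z zL1).
  apply: card_transporter_le => //; apply: contraNneq g1 => E.
  have uz : z \in unitmx by rewrite unitmxE dz unitr1.
  by rewrite -(mulKmx uz (GLval g)) E mulVmx.
have le2 : (\sum_(z in L :\: L1) T z <= (#|F| ^ 2 + 2 * #|F|) * (#|F| + 4))%N.
  apply: leq_trans (leq_mul (card_trace_locus_le g_nscal det_g) (leqnn _)).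
  apply: leq_trans (leq_mul (subset_leq_card (subsetDl L L1)) (leqnn _)).
  by rewrite -sum_nat_const; apply: leq_sum => z /regularP[].
rewrite card_comm_fiberE; apply: leq_trans (leq_add le1 le2) _.
move: #|F| => q; nia.
Qed.

(** At least q^2 - 5q regular [z] contribute at least q - 4 each, and (q^2 - 5q)(q - 4) >= q^3 - 9
    q^2. *)
Lemma card_comm_fiber_ge : (#|F| ^ 3 <= #|comm_fiber g| + 9 * #|F| ^ 2)%N.
Proof.
set S := L :\: L1.
have le1 : (#|S| * #|F| <= \sum_(z in S) T z + #|S| * 4)%N.
  by rewrite -!sum_nat_const -big_split; apply: leq_sum => z /regularP[].
have le2 : (\sum_(z in S) T z <= #|comm_fiber g|)%N.
  by rewrite card_comm_fiberE leq_addl.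
have le3 : (#|F| ^ 2 <= #|S| + 4 * #|F| + #|F|)%N.
  apply: leq_trans (card_trace_locus_ge g_nscal det_g) _; rewrite leq_add2r.
  rewrite -/L -(cardsID L1) addnC leq_add2l.
  apply: leq_trans (subset_leq_card (subsetIr _ _)) _.
  exact: card_trace_locus_irregular.
have {le1 le2} : (#|S| * #|F| <= #|comm_fiber g| + #|S| * 4)%N.
  by apply: leq_trans le1 _; rewrite leq_add2r.
(* For q <= 4 the factor q - 4 is not positive, but then q^3 <= 9 q^2 already. *)
have [q4|q4] := leqP #|F| 4.
  move=> _; apply: leq_trans (leq_addl _ _).
  by rewrite expnS leq_mul2r (leq_trans q4) ?orbT.
move: le3; move: #|S| #|comm_fiber g| q4; move: #|F| => q s N q4 le3 le1; nia.
Qed.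

End CommutatorFiber.

(** * From the two counts to the bound on the ratio *)

Theorem theorem5p1p1 (R : realFieldType) :
  exists (C : R) (q0 : nat), 0 < C /\
    forall (q : nat) (F : finFieldType) (g : {'GL_2[F]}),
      #|F| = q -> odd q -> (q0 <= q)%N ->
      g \in SL2 F -> GLval g != 1%:M -> GLval g != - 1%:M ->
      `|commN R g - 1| <= C / q%:R.
Proof.
(* The fiber and the group differ by at most (22 + 1) q^2, and q >= 2 gives q^3 <= 2 #|SL2 F|; hence
   46 = 2 * 23. *)
exists 46, 2%N; split=> // q F g Fq oddq q2 gSL g1 gN1; subst q.
have leN := card_comm_fiber_le gSL oddq g1 gN1.
have geN := card_comm_fiber_ge gSL oddq g1 gN1.
have leG := card_SL2_le F; have geG := card_SL2_ge F.
rewrite /commN; move: leN geN leG geG q2.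
move: #|comm_fiber g| #|SL2 F| #|F| => N G q leN geN leG geG q2.
have qG : (q ^ 3 <= 2 * G)%N by nia.
have G0 : (0 < G)%N by nia.
have leNG : (N * q <= G * q + 46 * G)%N.
  have : (N <= G + 23 * q ^ 2)%N by lia.
  nia.
have leGN : (G * q <= N * q + 46 * G)%N.
  have : (G <= N + 10 * q ^ 2)%N by lia.
  nia.
have q0 : (0 < q)%N by lia.
have qR : 0 < q%:R :> R by rewrite ltr0n.
have GR : 0 < G%:R :> R by rewrite ltr0n.
have -> : N%:R / G%:R - 1 = (N%:R - G%:R) / G%:R :> R.
  by rewrite mulrBl divff ?gt_eqF.
rewrite normrM normfV (gtr0_norm GR) ler_pdivrMr // mulrAC ler_pdivlMr //.
rewrite -[X in _ * X](gtr0_norm qR) -normrM ler_norml.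
move: leNG leGN; rewrite -!(ler_nat R) !natrD !natrM => leNG leGN.
by apply/andP; split; lra.
Qed.
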